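(* Let $Y\subset\mathbb{P}^5$ be a cubic fourfold of type S6. Then $Y$ contains a singular point of corank at least $3$. Conversely, if $Y$ contains a singular point of corank $3$ or more, then $Y$ is of type S6.
   Context: We work over $\mathbb{C}$. A cubic fourfold is a hypersurface in $\mathbb{P}^5$ given by a nonzero cubic form in $x_0,\dots,x_5$. It is of type S6 if in suitable linear coordinates its equation is a linear combination of cubic monomials $x_0^{i_0}\cdots x_5^{i_5}$ of weight $\sum i_ja_j\le0$, where $(a_0,\dots,a_5)=(2,0,0,0,-1,-1)$; equivalently, its equation has the form $x_0q(x_4,x_5)+f(x_1,\dots,x_5)$ with $q$ a quadratic form and $f$ a cubic form. The corank of a hypersurface singularity $f(y_1,\dots,y_n)=0$ at the origin is $n$ minus the rank of the Hessian of $f$ at the origin (here $n=5$). *)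

(* Defs.v *)
From mathcomp Require Import all_boot all_order all_algebra.
From mathcomp Require Import complex reals mpoly.

Set Implicit Arguments.
Unset Strict Implicit.
Unset Printing Implicit Defensive.

Import Order.TTheory GRing.Theory Num.Theory.
Local Open Scope ring_scope.

Section CubicFourfolds.
Variable K : fieldType.

Section LinearCoordinates.
Variable n : nat.

(* The form F rewritten in the coordinates x' given by x = A x'. *)
Definition lin_subst (A : 'M[K]_n) (F : {mpoly K[n]}) : {mpoly K[n]} :=
  F \mPo [tuple (\sum_(k < n) A j k *: 'X_k) | j < n].

Definition monom_weight (a : n.-tuple int) (m : 'X_{1..n}) : int :=
  \sum_(j < n) tnth a j *+ m j.

End LinearCoordinates.

Definition cubic_fourfold (F : {mpoly K[6]}) : Prop :=
  F != 0 /\ F \is 3.-homog.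

Definition S6_weights : 6.-tuple int := [tuple 2; 0; 0; 0; -1; -1].

Definition type_S6 (F : {mpoly K[6]}) : Prop :=
  exists A : 'M[K]_6, A \in unitmx /\
    forall m : 'X_{1..6},
      m \in msupp (lin_subst A F) -> monom_weight S6_weights m <= 0.

Definition hessian0 (n : nat) (g : {mpoly K[n]}) : 'M[K]_n :=
  \matrix_(i, j) (g^`M(i)^`M(j)).@[fun=> 0].

Definition corank0 (n : nat) (g : {mpoly K[n]}) : nat := n - \rank (hessian0 g).

(* Points of P^n are given by nonzero homogeneous coordinate vectors. *)
Section ProjectivePoints.
Variable n : nat.
Implicit Types (F : {mpoly K[n.+1]}) (p : 'rV[K]_n.+1).

Definition singular_point F p : Prop :=
  [/\ p != 0, F.@[p 0] = 0 & forall i, F^`M(i).@[p 0] = 0].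

(* The equation of F = 0 in the affine chart x_i = 1, with the affine
   coordinates (the remaining x_j, in order) translated so that p becomes the
   origin; meaningful when p 0 i != 0. *)
Definition local_equation F p (i : 'I_n.+1) : {mpoly K[n]} :=
  F \mPo [tuple (if unlift i j is Some k
                  then 'X_(k : 'I_n) + (p 0 j / p 0 i)%:MP_[n] else 1)
          | j < n.+1].

(* Some chart containing p (when p != 0); which one does not affect the corank
   at a singular point of a homogeneous F. *)
Definition chart p : 'I_n.+1 := odflt ord0 [pick i | p 0 i != 0].

Definition corank_at F p : nat := corank0 (local_equation F p (chart p)).

End ProjectivePoints.

End CubicFourfolds.

(* Main.v *)
Require Import Defs.
From mathcomp Require Import all_boot all_order all_algebra.
From mathcomp Require Import complex reals mpoly.

Import Order.TTheory GRing.Theory Num.Theory.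
Local Open Scope ring_scope.

(** By Euler's relation the Hessian H(p) of a form F at a point p satisfies
    p H(p) = 0 exactly when p is singular, and then restricting H(p) to an
    affine chart does not change its rank; so the corank at a singular point p
    of F is 5 - rank H(p).  For a cubic form G, the entry (j, k) of the Hessian
    at e_0 is a positive multiple of the coefficient of x_0 x_j x_k, hence G
    only has monomials of weight at most 0 if and only if the rows 0, ..., 3 of
    its Hessian at e_0 vanish.  Since Hessians transform by congruence, F is of
    type S6 if and only if some nonzero p lies in the kernel of H(p) and this
    kernel has dimension at least 4; the coordinates are obtained by extending
    p to a basis whose first four vectors lie in the kernel. *)

Set Implicit Arguments.
Unset Strict Implicit.
Unset Printing Implicit Defensive.

(** Induction along the algebra operations rather than over monomials, so that the chain rule below
    reduces to the Leibniz rule. *)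
Lemma mpoly_gen_ind (K : fieldType) n (P : {mpoly K[n]} -> Prop) :
  P 1 -> (forall i, P 'X_i) ->
  (forall p q, P p -> P q -> P (p + q)) ->
  (forall p q, P p -> P q -> P (p * q)) ->
  (forall c p, P p -> P (c *: p)) -> forall p, P p.
Proof.
move=> P1 PX PD PM PZ; elim/mpolyind=> [|c m p _ _ IHp].
  by rewrite -(scale0r 1); apply: PZ.
apply: PD IHp; apply: PZ; rewrite mpolyXE_id.
apply: (big_ind P) => // i _.
by elim: (m i) => [|k IHk]; rewrite ?expr0 // exprS; apply: PM.
Qed.

Lemma mderivXU (K : fieldType) n (i j : 'I_n) :
  ('X_j : {mpoly K[n]})^`M(i) = (j == i)%:R.
Proof.
rewrite mderivX mnm1E; case: eqP => [->|_]; last by rewrite scale0r.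
by rewrite -[X in (X - _)%MM]add0m addmK mpolyX0 scale1r.
Qed.

(** * Euler's relation and Hessians of forms *)

Section Homogeneous.
Variables (K : fieldType) (n : nat).
Implicit Types (F : {mpoly K[n]}) (v : 'rV[K]_n).

Lemma dhomog_mdeg d F m : F \is d.-homog -> m \in msupp F -> mdeg m = d.
Proof. by move=> homF /(dhomog_mf homF). Qed.

Lemma dhomog_mderiv d F i : F \is d.+1.-homog -> F^`M(i) \is d.-homog.
Proof.
move=> homF; apply/dhomogP => m; rewrite mcoeff_msupp mcoeff_deriv => nz.
have: (m + U_(i))%MM \in msupp F.
  by rewrite mcoeff_msupp; apply: contraNneq nz => ->; rewrite mul0rn.
by move/(dhomog_mdeg homF); rewrite mdegD mdeg1 addn1 => -[].
Qed.

Lemma meval_dhomog_scale d F c v :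
  F \is d.-homog -> F.@[(c *: v) 0] = c ^+ d * F.@[v 0].
Proof.
move=> homF; rewrite !mevalE mulr_sumr; apply: eq_big_seq => m mF.
rewrite mulrCA -(dhomog_mdeg homF mF) mdegE expr_sum -big_split /=.
by congr (_ * _); apply: eq_bigr => i _; rewrite mxE exprMn.
Qed.

(** Monomial by monomial: ['X_i] times the [i]-th derivative of ['X_[m]] is [m i] times ['X_[m]],
    and the exponents add up to [d]. *)
Lemma euler_dhomog d F : F \is d.-homog -> \sum_i 'X_i * F^`M(i) = F *+ d.
Proof.
move=> homF; rewrite {2}(mpolyE F) -sumrMnl.
under eq_bigr do rewrite {1}(mpolyE F) raddf_sum mulr_sumr /=.
rewrite exchange_big /=; apply: eq_big_seq => m mF.
rewrite -(dhomog_mdeg homF mF) mdegE -sumrMnr; apply: eq_bigr => i _.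
rewrite mderivZ mderivX -!scalerAr scalerMnr -scaler_nat; congr (_ *: _).
(* When [m i] is 0 the monomial [m - U_(i)] is truncated, but its coefficient vanishes. *)
have [->|mi] := posnP (m i); first by rewrite !scale0r.
by rewrite -mpolyXD addmC submK // lep1mP -lt0n.
Qed.

Lemma meval_euler d F v :
  F \is d.-homog -> \sum_i v 0 i * F^`M(i).@[v 0] = F.@[v 0] *+ d.
Proof.
move=> /euler_dhomog /(congr1 (meval (v 0))); rewrite raddf_sum raddfMn /= => <-.
by apply: eq_bigr => i _; rewrite mevalM mevalXU.
Qed.

(** At the [i]-th unit vector only powers of ['X_i] survive, and homogeneity leaves a single one. *)
Lemma meval_delta_dhomog d F i :
  F \is d.-homog -> F.@[(delta_mx 0 i : 'rV_n) 0] = F@_(U_(i) *+ d).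
Proof.
move=> homF; rewrite {2}(mpolyE F) raddf_sum mevalE; apply: eq_big_seq => m mF.
rewrite /= mcoeffZ mcoeffX; congr (_ * _).
rewrite -(dhomog_mdeg homF mF).
have [mE|mN] := eqVneq m _.
  rewrite big1 // => j _; rewrite mxE eqxx /=.
  have [_|ji] := eqVneq j i; first by rewrite expr1n.
  by rewrite mE mulmnE mnm1E eq_sym (negPf ji) mul0n expr0.
(* A nonzero product has no factor 0 ^ k with k > 0, so [m] involves ['X_i] only. *)
apply/eqP; apply: contraNT mN => /prodf_neq0 nz; apply/eqP/mnmP => j.
have m0 k : k != i -> m k = 0%N.
  move=> ki; move: (nz k isT); rewrite mxE (negPf ki) andbF expr0n.
  by case: (m k) => // ?; rewrite eqxx.
rewrite mulmnE mnm1E mdegE (bigD1 i) //= big1 ?addn0 //.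
by have [->|/m0 ->] := eqVneq j i; rewrite ?mul1n ?mul0n.
Qed.

Definition hessian F v : 'M[K]_n :=
  \matrix_(i, j) (F^`M(i)^`M(j)).@[v 0].

Lemma tr_hessian F v : (hessian F v)^T = hessian F v.
Proof. by apply/matrixP => i j; rewrite !mxE mderiv_comm. Qed.

Lemma hessian_scale d F c v :
  F \is d.+2.-homog -> hessian F (c *: v) = c ^+ d *: hessian F v.
Proof.
move=> homF; apply/matrixP => i j; rewrite !mxE.
by rewrite (@meval_dhomog_scale d) //; do 2!apply: dhomog_mderiv.
Qed.

(** Euler's relation for the partial derivatives, of degree [d.+1], gives the entries of
    [v *m hessian F v] as multiples of those derivatives at [v]. *)
Lemma mul_hessian d F v : F \is d.+2.-homog ->
  (forall i, F^`M(i).@[v 0] = 0) -> v *m hessian F v = 0.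
Proof.
move=> homF dF0; rewrite -tr_hessian; apply/rowP => j; rewrite !mxE.
under eq_bigr do rewrite !mxE.
by rewrite (meval_euler v (dhomog_mderiv j homF)) dF0 mul0rn.
Qed.

End Homogeneous.

(** * Chain rule and congruence of Hessians under affine substitutions *)

Section AffineSubstitution.
Variables (K : fieldType) (n m : nat).
Implicit Types (F : {mpoly K[n]}) (v : 'rV[K]_m).

Lemma mderiv_comp_mpoly F (t : n.-tuple {mpoly K[m]}) i :
  (F \mPo t)^`M(i) = \sum_j (F^`M(j) \mPo t) * (tnth t j)^`M(i).
Proof.
elim/mpoly_gen_ind: F => [|k|p q IHp IHq|p q IHp IHq|c p IHp].
- rewrite comp_mpoly1 -mpolyC1 mderivC big1 // => j _.
  by rewrite -mpolyC1 mderivC comp_mpoly0 mul0r.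
- rewrite comp_mpolyXU -tnth_nth (bigD1 k) //= big1 ?addr0 => [|j jk].
    by rewrite mderivXU eqxx comp_mpoly1 mul1r.
  by rewrite mderivXU eq_sym (negPf jk) comp_mpoly0 mul0r.
- rewrite comp_mpolyD mderivD IHp IHq -big_split; apply: eq_bigr => j _ /=.
  by rewrite mderivD comp_mpolyD mulrDl.
- rewrite rmorphM /= mderivM IHp IHq mulr_suml mulr_sumr -big_split.
  apply: eq_bigr => j _ /=; rewrite mderivM comp_mpolyD !rmorphM mulrDl /=.
  by rewrite mulrAC mulrA.
- rewrite comp_mpolyZ mderivZ IHp scaler_sumr; apply: eq_bigr => j _ /=.
  by rewrite mderivZ comp_mpolyZ scalerAl.
Qed.

(* The substitution x = B y + b. *)
Definition affine_subst (B : 'M[K]_(n, m)) (b : 'rV[K]_n) F : {mpoly K[m]} :=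
  F \mPo [tuple \sum_(k < m) B j k *: 'X_k + (b 0 j)%:MP | j < n].

Variables (B : 'M[K]_(n, m)) (b : 'rV[K]_n).

Lemma meval_affine_subst F v :
  (affine_subst B b F).@[v 0] = F.@[(v *m B^T + b) 0].
Proof.
rewrite comp_mpoly_meval; apply: meval_eq => j.
rewrite tnth_mktuple mevalD mevalC raddf_sum !mxE /=; congr (_ + _).
by apply: eq_bigr => k _; rewrite mevalZ mevalXU mxE mulrC.
Qed.

Lemma mderiv_affine_subst F i :
  (affine_subst B b F)^`M(i) = \sum_j B j i *: affine_subst B b F^`M(j).
Proof.
rewrite mderiv_comp_mpoly; apply: eq_bigr => j _.
suff ->: (tnth [tuple \sum_k B j k *: 'X_k + (b 0 j)%:MP | j < n] j)^`M(i)
       = (B j i)%:MP by rewrite mulrC mul_mpolyC.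
rewrite tnth_mktuple mderivD mderivC addr0 (bigD1 i) //= mderivD mderivZ.
rewrite mderivXU eqxx alg_mpolyC raddf_sum [X in _ + X]big1 ?addr0 // => k ki.
by rewrite /= mderivZ mderivXU (negPf ki) scaler0.
Qed.

(** The chain rule is applied twice; as the substitution is affine, its second derivatives
    contribute no term. *)
Lemma hessian_affine_subst F v :
  hessian (affine_subst B b F) v =
  B^T *m hessian F (v *m B^T + b) *m B.
Proof.
apply/matrixP => i j; rewrite !mxE mderiv_affine_subst.
rewrite (raddf_sum (mderiv j)) (raddf_sum (meval (v 0))) /=.
under [RHS]eq_bigr => k _ do rewrite mxE mulr_suml.
rewrite [RHS]exchange_big /=; apply: eq_bigr => k _.
rewrite mderivZ mevalZ mderiv_affine_subst raddf_sum mulr_sumr /=.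
apply: eq_bigr => l _; rewrite mevalZ meval_affine_subst !mxE.
by rewrite mulrA mulrAC.
Qed.

End AffineSubstitution.

(** * The corank in a chart, computed from the homogeneous Hessian *)

Section LocalEquation.
Variables (K : fieldType) (n : nat).
Implicit Types (F : {mpoly K[n.+1]}) (p : 'rV[K]_n.+1).

Lemma chartP p : p != 0 -> p 0 (chart p) != 0.
Proof.
move=> p0; rewrite /chart; case: pickP => //= p_eq0; case/eqP: p0.
by apply/rowP => i; rewrite mxE; apply/eqP/negbFE/p_eq0.
Qed.

(** The linear part of the chart: the inclusion of the hyperplane x_i = 0. *)
Definition lift_mx (i : 'I_n.+1) : 'M[K]_(n.+1, n) :=
  \matrix_(j, k) (j == lift i k)%:R.

Lemma local_equation_affine F p i : p 0 i != 0 ->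
  local_equation F p i = affine_subst (lift_mx i) ((p 0 i)^-1 *: p) F.
Proof.
move=> pi0; congr (_ \mPo _); apply: eq_from_tnth => j; rewrite !tnth_mktuple.
rewrite mxE mulrC; case: unliftP => [k ->|->].
  rewrite (bigD1 k) //= big1 ?addr0 => [|l lk].
    by rewrite mxE eqxx scale1r.
  by rewrite mxE (inj_eq lift_inj) eq_sym (negPf lk) scale0r.
rewrite mulVf // mpolyC1 big1 ?add0r // => k _.
by rewrite mxE (negPf (neq_lift i k)) scale0r.
Qed.

(* The kernel vector w spans a complement of the hyperplane x_i = 0, so no rank
   is lost by restricting the form H to that hyperplane. *)
Lemma mxrank_restrict_hyperplane (H : 'M[K]_n.+1) (w : 'rV[K]_n.+1) i :
  H^T = H -> w *m H = 0 -> w 0 i != 0 ->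
  \rank ((lift_mx i)^T *m H *m lift_mx i) = \rank H.
Proof.
move=> symH wH wi0; apply/eqP; rewrite eqn_leq; apply/andP; split.
  exact: leq_trans (mxrankM_maxl _ _) (mxrankM_maxr _ _).
(* On row vectors, [1%:M - u *m w] sends x to x - (x_i / w_i) w: the projection onto x_i = 0 along
   [w]. [V] is this projection followed by dropping the [i]-th coordinate. *)
pose u : 'cV[K]_n.+1 := (w 0 i)^-1 *: delta_mx i 0.
pose V := (1%:M - u *m w) *m lift_mx i.
have dec : V *m (lift_mx i)^T + u *m w = 1%:M.
  apply/matrixP => j l; rewrite [LHS]mxE [(V *m _) j l]mxE.
  have uwE k : (u *m w) j k = (j == i)%:R * (w 0 k / w 0 i).
    by rewrite mxE big_ord1 !mxE andbT -mulrA mulrC -mulrA.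
  have VE k : V j k = (1%:M - u *m w) j (lift i k).
    rewrite mxE (bigD1 (lift i k)) //= big1 => [|m mk].
      by rewrite [lift_mx _ _ _]mxE eqxx mulr1 addr0.
    by rewrite [lift_mx _ _ _]mxE (negPf mk) mulr0.
  rewrite uwE; case: (unliftP i l) => [k ->|->].
    rewrite (bigD1 k) //= big1 => [|m mk].
      rewrite VE [_^T _ _]mxE [lift_mx _ _ _]mxE eqxx mulr1 addr0.
      by rewrite [(1%:M - _) _ _]mxE [(- (u *m w)) _ _]mxE uwE subrK.
    by rewrite [_^T _ _]mxE [lift_mx _ _ _]mxE (inj_eq lift_inj) eq_sym (negPf mk) mulr0.
  rewrite big1 => [|k _]; last first.
    by rewrite [_^T _ _]mxE [lift_mx _ _ _]mxE (negPf (neq_lift i k)) mulr0.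
  by rewrite divff // mulr1 add0r mxE.
have HE : V *m (lift_mx i)^T *m H = H.
  by rewrite -[RHS]mul1mx -dec mulmxDl -[u *m w *m H]mulmxA wH mulmx0 addr0.
have HE' : H *m lift_mx i *m V^T = H.
  by have := congr1 trmx HE; rewrite !trmx_mul trmxK symH mulmxA.
(* Since [w] is in the kernel, [H] is recovered from its restriction by multiplying with [V] and
   [V^T], so its rank cannot be larger. *)
suff {1}<-: V *m ((lift_mx i)^T *m H *m lift_mx i) *m V^T = H.
  exact: leq_trans (mxrankM_maxl _ _) (mxrankM_maxr _ _).
by rewrite !mulmxA HE HE'.
Qed.

(** The local Hessian is the restriction to x_i = 0 of the Hessian at p / p_i. Rescaling the point
    multiplies the Hessian by a nonzero scalar, and [p] itself serves as the kernel vector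
    transverse to the hyperplane. *)
Lemma corank_at_hessian d F p : F \is d.+2.-homog -> singular_point F p ->
  corank_at F p = (n - \rank (hessian F p))%N.
Proof.
move=> homF [p0 _ dFp]; have pi0 := chartP p0.
rewrite /corank_at /corank0; congr (_ - _)%N.
rewrite -(mxrank_restrict_hyperplane (tr_hessian F p) (mul_hessian homF dFp) pi0).
have ->: hessian0 (local_equation F p (chart p)) =
         hessian (local_equation F p (chart p)) 0.
  by apply/matrixP => i j; rewrite !mxE; apply: meval_eq => k; rewrite mxE.
rewrite local_equation_affine // hessian_affine_subst mul0mx add0r.
rewrite (hessian_scale _ _ homF) -scalemxAr -scalemxAl eqmx_scale //.
by rewrite expf_neq0 ?invr_eq0.
Qed.

End LocalEquation.

(** * Linear changes of coordinates *)

Section LinearSubstitution.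
Variables (K : fieldType) (n : nat).
Implicit Types (F : {mpoly K[n]}) (A : 'M[K]_n).

Lemma lin_subst_affine A F : lin_subst A F = affine_subst A 0 F.
Proof.
congr (_ \mPo _); apply: eq_from_tnth => j.
by rewrite !tnth_mktuple mxE mpolyC0 addr0.
Qed.

Lemma hessian_lin_subst A F v :
  hessian (lin_subst A F) v = A^T *m hessian F (v *m A^T) *m A.
Proof. by rewrite lin_subst_affine hessian_affine_subst addr0. Qed.

Lemma dhomog_lin_subst d A F : F \is d.-homog -> lin_subst A F \is d.-homog.
Proof.
move=> homF; rewrite /lin_subst comp_mpolyE big_seq; apply: rpred_sum => m mF.
apply: dhomogZ; rewrite -(dhomog_mdeg homF mF) mdegE.
pose hom (q : {mpoly K[n]}) k := q \is k.-homog.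
apply: (big_ind2 hom) => [|q k q' k'|i _]; rewrite /hom.
- exact: dhomog1.
- exact: dhomogM.
rewrite tnth_mktuple -[X in X.-homog](mul1n (m i)).
apply: dhomogMn; apply: rpred_sum => k _; apply: dhomogZ.
by rewrite dhomogX /= mdeg1.
Qed.

End LinearSubstitution.

(** Used twice: to complete [p] to four independent kernel vectors, then to complete these to a
    basis of the whole space. *)
Lemma row_free_extend (K : fieldType) k r n (A : 'M[K]_(k, n)) (V : 'M[K]_n) :
  row_free A -> (A <= V)%MS -> (k + r <= \rank V)%N ->
  exists B : 'M[K]_(r, n), (B <= V)%MS /\ row_free (col_mx A B).
Proof.
move=> freeA AV rkV; pose W := (V :\: A)%MS.
have rkW : (r <= \rank W)%N.
  have := mxrank_cap_compl V A; rewrite (capmx_idPr AV) (eqP freeA) => rVE.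
  by rewrite -(leq_add2l k) rVE.
(* The first [r] vectors of a basis of a complement of [A] in [V]. *)
pose B : 'M[K]_(r, n) := pid_mx r *m row_base W.
have BW : (B <= W)%MS by apply: submx_trans (submxMl _ _) _; rewrite eq_row_base.
exists B; split; first exact: submx_trans BW (diffmxSl _ _).
have rkB : \rank B = r by rewrite mxrankMfree ?row_base_free // rank_pid_mx.
rewrite /row_free -addsmxE mxrank_disjoint_sum ?rkB ?(eqP freeA) //.
by apply/eqP; rewrite -submx0 -(capmx_diff V A) capmxC capmxS.
Qed.

(** * Cubic forms over a field of characteristic zero, and type S6 *)

Section Cubics.
Variable K : numFieldType.

(** Converse of [mul_hessian]: Euler's relation for the partial derivatives, then for [F], where
    characteristic zero allows cancelling [d.+1] and [d.+2]. *)
Lemma singular_point_hessian d n (F : {mpoly K[n.+1]}) (w : 'rV[K]_n.+1) :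
  F \is d.+2.-homog -> w != 0 -> w *m hessian F w = 0 -> singular_point F w.
Proof.
move=> homF w0 wH.
have dF i : F^`M(i).@[w 0] = 0.
  apply/eqP; have := meval_euler w (dhomog_mderiv i homF).
  move/eqP; rewrite eq_sym; suff ->: \sum_j w 0 j * F^`M(i)^`M(j).@[w 0] = 0.
    by rewrite mulrn_eq0.
  move/rowP/(_ i): wH; rewrite !mxE => {2}<-.
  by apply: eq_bigr => j _; rewrite mxE mderiv_comm.
split => //; apply/eqP; have := meval_euler w homF; move/eqP.
by rewrite big1 => [|i _]; rewrite ?dF ?mulr0 // eq_sym mulrn_eq0.
Qed.

Lemma hessian_delta_eq0 n (G : {mpoly K[n]}) i j k : G \is 3.-homog ->
  (hessian G (delta_mx 0 i) j k == 0) = (G@_(U_(i) + U_(j) + U_(k)) == 0).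
Proof.
move=> homG; rewrite mxE (@meval_delta_dhomog _ _ 1); last first.
  by do 2!apply: dhomog_mderiv.
rewrite !mcoeff_deriv -mulrnA mulrn_eq0 /= -addmA [(U_(k) + _)%MM]addmC addmA.
by rewrite mulm1n.
Qed.

Lemma monom_weightD n (a : n.-tuple int) m1 m2 :
  monom_weight a (m1 + m2)%MM = monom_weight a m1 + monom_weight a m2.
Proof.
by rewrite -big_split; apply: eq_bigr => j _; rewrite mnmDE mulrnDr.
Qed.

Lemma monom_weightU n (a : n.-tuple int) i : monom_weight a U_(i)%MM = tnth a i.
Proof.
rewrite /monom_weight (bigD1 i) //= big1 => [|j ji].
  by rewrite mnm1E eqxx addr0.
by rewrite mnm1E eq_sym (negPf ji).
Qed.

Lemma mnm_subU n (m : 'X_{1..n}) i : m i != 0%N -> exists m', m = (U_(i) + m')%MM.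
Proof. by move=> mi; exists (m - U_(i))%MM; rewrite addmC submK // lep1mP. Qed.

(** A cubic monomial divisible by x_0 has weight at most 0 only if both other factors are among x_4,
    x_5; one not divisible by x_0 never has positive weight. *)
Lemma S6_monomsP (G : {mpoly K[6]}) : G \is 3.-homog ->
  (forall m, m \in msupp G -> monom_weight S6_weights m <= 0) <->
  (forall j k : 'I_6, (j < 4)%N -> hessian G (delta_mx 0 0) j k = 0).
Proof.
move=> homG; split=> [wtG j k j4 | H0 m mG].
  apply/eqP; rewrite hessian_delta_eq0 // mcoeff_eq0; apply/negP => /wtG.
  rewrite !monom_weightD !monom_weightU.
  (* The weight is at least 2 + 0 - 1 > 0. *)
  by case: j j4 => [[|[|[|[|?]]]] ?] // _; case: k => [[|[|[|[|[|[|?]]]]]] ?].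
have [m0|/mnm_subU[m' mE]] := eqVneq (m 0) 0%N.
  rewrite /monom_weight !big_ord_recl big_ord0 m0 /S6_weights.
  rewrite !(tnth_nth 0) /= !mul0rn !add0r addr0 !mulNrn.
  by rewrite -opprD oppr_le0 addr_ge0 // mulrn_wge0.
have deg_m' : mdeg m' = 2.
  by have := dhomog_mdeg homG mG; rewrite mE mdegD mdeg1 => -[].
have [j m'j] : exists j, m' j != 0%N.
  apply/existsP; rewrite -negb_forall; apply/negP => /forallP m'0.
  by move: deg_m'; rewrite mdegE big1 // => j _; apply/eqP.
have [m2 m'E] := mnm_subU m'j.
have /mdeg1P[k /eqP m2E] : mdeg m2 == 1%N.
  by move: deg_m'; rewrite m'E mdegD mdeg1 => /(@addnI 1 _ 1)->.
move: mG; rewrite mE m'E m2E addmA mcoeff_msupp -hessian_delta_eq0 // => Hjk.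
have j4 : (4 <= j)%N by rewrite leqNgt; apply: contra Hjk => /H0->.
have k4 : (4 <= k)%N.
  (* Symmetry of the Hessian turns the vanishing rows into vanishing columns. *)
  by rewrite leqNgt; apply: contra Hjk => /H0 Hkj; rewrite -tr_hessian mxE Hkj.
rewrite !monom_weightD !monom_weightU.
by case: j j4 {m'j m'E Hjk} => [[|[|[|[|[|[|?]]]]]] ?] // _;
   case: k k4 {m2E} => [[|[|[|[|[|[|?]]]]]] ?].
Qed.

Lemma type_S6_singular_point (F : {mpoly K[6]}) : F \is 3.-homog -> type_S6 F ->
  exists p : 'rV[K]_6, singular_point F p /\ (3 <= corank_at F p)%N.
Proof.
move=> homF [A [unitA]]; have homG := dhomog_lin_subst A homF.
move/(S6_monomsP homG) => H0; pose p : 'rV[K]_6 := delta_mx 0 0 *m A^T.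
have HE := hessian_lin_subst A F (delta_mx 0 0); rewrite -/p in HE.
have freeA : row_free A by rewrite row_free_unit.
have freeAT : row_free A^T by rewrite row_free_unit unitmx_tr.
have p0 : p != 0.
  apply/eqP => /(canRL (mulmxK _)); rewrite unitmx_tr mul0mx => /(_ unitA).
  by move/rowP/(_ 0)/eqP; rewrite !mxE oner_eq0.
have pH : p *m hessian F p = 0.
  (* After right multiplication by [A], the left side becomes row 0 of the Hessian in the new
     coordinates. *)
  apply: (row_free_inj freeA).
  rewrite mul0mx {1}/p -[_ *m A^T *m _]mulmxA -mulmxA -HE -rowE.
  by apply/rowP => k; rewrite mxE H0 ?mxE.
have sing := singular_point_hessian homF p0 pH.
exists p; split => //; rewrite (corank_at_hessian homF sing).
suff rkH : (\rank (hessian F p) <= 2)%N by rewrite -[3%N]/(5 - 2)%N leq_sub2l.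
have ->: \rank (hessian F p) = \rank (hessian (lin_subst A F) (delta_mx 0 0)).
  rewrite HE mxrankMfree // -[in RHS]mxrank_tr trmx_mul trmxK mxrankMfree //.
  by rewrite mxrank_tr.
(* Only the last two of the six rows of [G] can be nonzero. *)
set G := hessian _ _; rewrite -[G](@vsubmxK _ 4 2).
have ->: @usubmx _ 4 2 _ G = 0.
  by apply/matrixP => i j; rewrite [LHS]mxE [RHS]mxE H0 //=; apply: ltn_ord.
by rewrite (@rank_col_0mx _ 2 6 4) rank_leq_row.
Qed.

Lemma singular_point_type_S6 (F : {mpoly K[6]}) (p : 'rV[K]_6) :
  F \is 3.-homog -> singular_point F p -> (3 <= corank_at F p)%N -> type_S6 F.
Proof.
move=> homF sing; rewrite (corank_at_hessian homF sing); case: sing => p0 _ dFp.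
set H := hessian F p => rkH; have pH : p *m H = 0 := mul_hessian homF dFp.
have freep : row_free p by rewrite /row_free rank_rV p0.
(* Corank at least 3 in five affine coordinates means rank at most 2, so the kernel has dimension at
   least 4 = 1 + 3: room for [p] and three more vectors. *)
have rkK : (1 + 3 <= \rank (kermx H))%N.
  by rewrite mxrank_ker ltn_subRL addn3; move: rkH; rewrite ltn_subRL addn2.
have [B [BK freeB]] := row_free_extend freep (introT sub_kermxP pH) rkK.
have rk1 : (1 + 3 + 2 <= \rank (1%:M : 'M[K]_6))%N by rewrite mxrank1.
have [C [_ freeN]] := row_free_extend freeB (submx1 _) rk1.
pose N : 'M[K]_6 := col_mx (col_mx p B) C.
(* The new basis vectors are the rows of [N], while [lin_subst] expects them as columns. *)
exists N^T; split; first by rewrite unitmx_tr -row_free_unit.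
apply/(S6_monomsP (dhomog_lin_subst _ homF)) => j k j4.
rewrite hessian_lin_subst trmxK.
have ->: delta_mx 0 0 *m N = p.
  rewrite -rowE; apply/rowP => i; rewrite mxE.
  have ->: N 0 i = N (lshift 2 (lshift 3 (0 : 'I_1))) i.
    by congr (N _ i); apply: val_inj.
  by rewrite (@col_mxEu _ (1 + 3) 2) (@col_mxEu _ 1 3).
(* The first four basis vectors lie in the kernel, which gives the vanishing rows 0 to 3. *)
have NH : N *m H = col_mx (0 : 'M_(1 + 3, 6)) (C *m H).
  rewrite (@mul_col_mx _ (1 + 3) 2) (@mul_col_mx _ 1 3) pH.
  by rewrite (sub_kermxP BK) col_mx0.
rewrite -/H NH mxE big1 // => l _.
have ->: j = lshift 2 (Ordinal j4 : 'I_(1 + 3)) by apply: val_inj.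
by rewrite (@col_mxEu _ (1 + 3) 2) mxE mul0r.
Qed.

End Cubics.

Theorem lemma3p7 (R : realType) (F : {mpoly (complex R)[6]}) :
  cubic_fourfold F ->
  (type_S6 F ->
     exists p : 'rV[complex R]_6, singular_point F p /\ (3 <= corank_at F p)%N)
  /\
  ((exists p : 'rV[complex R]_6, singular_point F p /\ (3 <= corank_at F p)%N) ->
     type_S6 F).
Proof.
move=> [_ homF]; split; first exact: type_S6_singular_point.
by move=> [p [sing rk]]; apply: singular_point_type_S6 homF sing rk.
Qed.
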